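(* Let $A\in\mathbb{R}^{n\times n}$, $b,x_0\in\mathbb{R}^n$, $r_0=b-Ax_0$, and let $\ell$ be the maximal dimension of the Krylov subspaces $\mathcal{K}_k(A,r_0)$, $k\ge0$. Let $$x_k=\operatorname*{argmin}_{x\in x_0+\mathcal{K}_k(A,r_0)}\|b-Ax\|,\qquad x_k^{\mathrm A}=\operatorname*{argmin}_{x\in x_0+\mathcal{K}_k(A,r_0)}\|A(b-Ax)\|$$ denote the $k$th GMRES iterate and the $k$th RSMAR iterate, respectively. If $\mathrm{range}(A)=\mathrm{range}(A^\top)$ and $b\in\mathrm{range}(A)$, then $x_\ell^{\mathrm A}=x_\ell$. If $\mathrm{range}(A)=\mathrm{range}(A^\top)$ and $b\notin\mathrm{range}(A)$, then $x_{\ell-1}^{\mathrm A}=x_{\ell-1}$.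
   Context: For a matrix $A\in\mathbb{R}^{n\times n}$ and a vector $v\in\mathbb{R}^n$, the $k$th Krylov subspace is $\mathcal{K}_k(A,v)=\mathrm{span}\{v,Av,\ldots,A^{k-1}v\}$, with $\mathcal{K}_0(A,v)=\{0\}$. The integer $\ell$ is characterized by $\dim\mathcal{K}_k(A,r_0)=k$ for $k\le\ell$ and $\dim\mathcal{K}_k(A,r_0)=\ell$ for $k\ge\ell+1$. $\|\cdot\|$ is the Euclidean norm. For the indices appearing in the conclusions (under the respective hypotheses) the minimizers are unique, so the iterates are well defined. *)

(* Defs.v *)
From HB Require Import structures.
From mathcomp Require Import all_boot all_order all_algebra.
From mathcomp Require Import reals.

Set Implicit Arguments.
Unset Strict Implicit.
Unset Printing Implicit Defensive.

Import Order.TTheory GRing.Theory Num.Theory.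
Local Open Scope ring_scope.

(* The norm that MathComp-Analysis puts on matrices is the max norm, hence a
   separate definition. *)
Definition enorm (R : realType) (n : nat) (v : 'cV[R]_n) : R :=
  Num.sqrt (\sum_(i < n) v i 0 ^+ 2).

Definition mxrange (R : realType) (n : nat) (A : 'M[R]_n) :
    {vspace 'cV[R]_n} :=
  limg (linfun (mulmx A : 'cV[R]_n -> 'cV[R]_n)).

(* [iter i (mulmx A) v] is A^i v; the ring power [A ^+ i] is not available
   for an arbitrary dimension n. *)
Definition krylov (R : realType) (n : nat) (A : 'M[R]_n) (v : 'cV[R]_n)
    (k : nat) : {vspace 'cV[R]_n} :=
  <<mkseq (fun i => iter i (mulmx A) v) k>>%VS.

Definition is_max_krylov_dim (R : realType) (n : nat) (A : 'M[R]_n)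
    (v : 'cV[R]_n) (l : nat) : Prop :=
  (exists k, \dim (krylov A v k) = l) /\
  (forall k, (\dim (krylov A v k) <= l)%N).

Definition is_argmin (R : realType) (T : Type) (P : T -> Prop) (f : T -> R)
    (x : T) : Prop :=
  P x /\ forall y, P y -> f x <= f y.

Definition krylov_affine (R : realType) (n : nat) (A : 'M[R]_n)
    (b x0 : 'cV[R]_n) (k : nat) (x : 'cV[R]_n) : Prop :=
  x - x0 \in krylov A (b - A *m x0) k.

(* An iterate is "the" minimizer: [unique P x] says that x satisfies P and is
   the only vector that does. *)
Definition is_gmres_iterate (R : realType) (n : nat) (A : 'M[R]_n)
    (b x0 : 'cV[R]_n) (k : nat) : 'cV[R]_n -> Prop :=
  unique (is_argmin (krylov_affine A b x0 k)
                    (fun x => enorm (b - A *m x))).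

Definition is_rsmar_iterate (R : realType) (n : nat) (A : 'M[R]_n)
    (b x0 : 'cV[R]_n) (k : nat) : 'cV[R]_n -> Prop :=
  unique (is_argmin (krylov_affine A b x0 k)
                    (fun x => enorm (A *m (b - A *m x)))).

(* Main.v *)
(** If range(A) = range(A^T) then ker A and range A are orthogonal.  Hence a
    correction y with A (r0 - A y) = 0 not only annihilates the RSMAR objective
    but also, by Pythagoras, minimizes the GMRES residual; both minimizers are
    unique as soon as A is injective on the Krylov space.  Such a y exists in
    K_k whenever A is injective on K_k and A K_(k+1) lies in A K_k: then A
    restricts to an injective, hence onto, endomorphism of A K_k, and A r0 is
    in A K_k.  For b in range(A) this applies with k = l, since K_(l+1) = K_l
    is contained in range(A); otherwise it applies with k = l - 1, because
    A K_l is contained in K_l but misses r0, hence has dimension at most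
    l - 1 = dim A K_(l-1). *)
Require Import Defs.
From HB Require Import structures.
From mathcomp Require Import all_boot all_order all_algebra.
From mathcomp Require Import reals.

Set Implicit Arguments.
Unset Strict Implicit.
Unset Printing Implicit Defensive.

Import Order.TTheory GRing.Theory Num.Theory.
Local Open Scope ring_scope.

(** * Euclidean norm and Pythagoras *)

Section EuclideanNorm.
Variables (R : realType) (n : nat).
Implicit Types u v : 'cV[R]_n.

Lemma enormE v : enorm v = Num.sqrt ((v^T *m v) 0 0).
Proof.
by rewrite /enorm mxE; congr Num.sqrt; apply: eq_bigr => i _; rewrite mxE expr2.
Qed.

Lemma dotmx_ge0 v : 0 <= (v^T *m v) 0 0.
Proof. by rewrite mxE sumr_ge0 // => i _; rewrite mxE -expr2 sqr_ge0. Qed.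

Lemma dotmx_eq0 v : (v^T *m v) 0 0 = 0 -> v = 0.
Proof.
rewrite mxE => /eqP; rewrite psumr_eq0 => [/allP v0|i _].
  apply/matrixP => i j; rewrite ord1 [RHS]mxE; apply/eqP.
  by have := v0 i (mem_index_enum i); rewrite mxE -expr2 sqrf_eq0.
by rewrite mxE -expr2 sqr_ge0.
Qed.

Lemma enorm_ge0 v : 0 <= enorm v.
Proof. exact: sqrtr_ge0. Qed.

Lemma enorm0 : enorm (0 : 'cV[R]_n) = 0.
Proof. by rewrite enormE mulmx0 mxE sqrtr0. Qed.

Lemma enorm_le0 v : enorm v <= 0 -> v = 0.
Proof.
move=> v_le0; apply/dotmx_eq0/eqP; rewrite eq_le dotmx_ge0 andbT.
by rewrite -sqrtr_eq0 -enormE eq_le v_le0 enorm_ge0.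
Qed.

Lemma dotmx_pythagoras u v : v^T *m u = 0 ->
  ((u + v)^T *m (u + v)) 0 0 = (u^T *m u) 0 0 + (v^T *m v) 0 0.
Proof.
move=> vu0; have uv0 : u^T *m v = 0 by rewrite -[v]trmxK -trmx_mul vu0 trmx0.
by rewrite [(u + v)^T]linearD /= mulmxDl !mulmxDr vu0 uv0 add0r addr0 mxE.
Qed.

Lemma enorm_leDr u v : v^T *m u = 0 -> enorm u <= enorm (u + v).
Proof.
by move=> vu0; rewrite !enormE ler_wsqrtr // dotmx_pythagoras // lerDl dotmx_ge0.
Qed.

(** The equality case of the preceding bound; it yields uniqueness of the GMRES minimizer. *)
Lemma enorm_leDr_eq0 u v : v^T *m u = 0 -> enorm (u + v) <= enorm u -> v = 0.
Proof.
move=> vu0; rewrite !enormE ler_sqrt ?dotmx_ge0 // dotmx_pythagoras //.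
rewrite gerDl => v_le0; apply/dotmx_eq0/eqP.
by rewrite eq_le v_le0 dotmx_ge0.
Qed.

End EuclideanNorm.

(** * Growth and stabilization of Krylov spaces *)

Section Krylov.
Variables (R : realType) (n : nat) (A : 'M[R]_n).
Implicit Types (v w z : 'cV[R]_n) (k l m p : nat).

Let f : 'End('cV[R]_n) := linfun (mulmx A : 'cV[R]_n -> 'cV[R]_n).

Lemma mulmx_linfunE v : f v = A *m v.
Proof. by rewrite lfunE. Qed.

Lemma krylovS v k : krylov A v k.+1 = (<[v]> + f @: krylov A v k)%VS.
Proof.
rewrite /krylov /mkseq /= span_cons; congr (_ + _)%VS.
(* The tail of the spanning list has exponents 1 to [k]; shifting them to start at 0 exposes one
   factor [A]. *)
rewrite limg_span -map_comp (iotaDl 1 0) -map_comp; congr <<_>>%VS.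
by apply: eq_map => i /=; rewrite mulmx_linfunE.
Qed.

Lemma krylov_sub v k m : (k <= m)%N -> (krylov A v k <= krylov A v m)%VS.
Proof.
move=> le_km; apply: sub_span => z /mapP[i]; rewrite mem_iota add0n => /= i_k ->.
by apply: map_f; rewrite mem_iota add0n /= (leq_trans i_k).
Qed.

Lemma dim_krylov_le v k : (\dim (krylov A v k) <= k)%N.
Proof. by rewrite (leq_trans (dim_span _)) // size_mkseq. Qed.

(** By induction, K_(p+1) = <v> + A K_p lies in <v> + A K_m = K_(m+1), hence in K_m. *)
Lemma krylov_stable v m : (krylov A v m.+1 <= krylov A v m)%VS ->
  forall p, (krylov A v p <= krylov A v m)%VS.
Proof.
move=> subm; elim=> [|p IHp]; first by rewrite /krylov /mkseq /= span_nil sub0v.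
apply: subv_trans subm; rewrite !krylovS.
exact: addvS (subvv _) (limgS _ IHp).
Qed.

(** Each step either gains a full dimension or gains none, and after the first step without gain the
    spaces stop growing. *)
Lemma dim_krylov_or_stable v m :
  \dim (krylov A v m) = m \/ forall p, (krylov A v p <= krylov A v m)%VS.
Proof.
elim: m => [|m [dimm|stabm]].
- by left; rewrite /krylov /mkseq /= span_nil dimv0.
- have [dimS|dimS] := leqP m.+1 (\dim (krylov A v m.+1)).
    by left; apply/eqP; rewrite eqn_leq dim_krylov_le.
  right=> p; suff /krylov_stable/(_ p) Kp : (krylov A v m.+1 <= krylov A v m)%VS.
    by apply: subv_trans Kp (krylov_sub _ (leqnSn m)).
  have := dimv_leqif_sup (krylov_sub v (leqnSn m)); rewrite dimm.
  by move=> /geq_leqif <-.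
- by right=> p; apply: subv_trans (stabm p) (krylov_sub _ (leqnSn m)).
Qed.

(** The maximum is attained at index [l] itself: if K_l is already stable, it contains the space of
    maximal dimension. *)
Lemma dim_max_krylov v l : is_max_krylov_dim A v l -> \dim (krylov A v l) = l.
Proof.
case=> [[k dimk] lel]; have [//|stab] := dim_krylov_or_stable v l.
by apply/eqP; rewrite eqn_leq lel -{1}dimk dimvS.
Qed.

Lemma max_krylovS v l : is_max_krylov_dim A v l ->
  krylov A v l.+1 = krylov A v l.
Proof.
move=> hl; apply/esym/eqP; rewrite eqEdim krylov_sub //= (dim_max_krylov hl).
exact: hl.2.
Qed.

Lemma limg_max_krylov v l : is_max_krylov_dim A v l ->
  (f @: krylov A v l <= krylov A v l)%VS.
Proof. by move=> hl; rewrite -{2}(max_krylovS hl) krylovS addvSr. Qed.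

(** In K_(k+1) = <v> + A K_k the line accounts for at most one dimension, which leaves [k] for A
    K_k. *)
Lemma dim_limg_krylov_pred v k :
  \dim (krylov A v k.+1) = k.+1 -> \dim (f @: krylov A v k) = k.
Proof.
move=> dimS; apply/eqP; rewrite eqn_leq; apply/andP; split.
  apply: leq_trans (dim_krylov_le v k).
  by rewrite -(limg_ker_dim f (krylov A v k)) leq_addl.
have := (dimv_add_leqif <[v]> (f @: krylov A v k)).1.
rewrite -krylovS dimS dim_vline => le_dim.
by rewrite -ltnS (leq_trans le_dim) // (leq_add2r _ _ 1) leq_b1.
Qed.

(** * Consequences of range(A) = range(A^T) *)

Section EqualRanges.
Hypothesis rangeT : mxrange A = mxrange A^T.

Lemma mem_mxrange v : A *m v \in mxrange A.
Proof. by rewrite -mulmx_linfunE memv_img ?memvf. Qed.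

(** Writing w = A^T u gives w^T z = u^T (A z) = 0. *)
Lemma mxrange_orth_ker w z : w \in mxrange A -> A *m z = 0 -> w^T *m z = 0.
Proof.
rewrite rangeT => /memv_imgP[u _ ->] Az0.
by rewrite lfunE /= trmx_mul trmxK -mulmxA Az0 mulmx0.
Qed.

Lemma mxrange_ker w : w \in mxrange A -> A *m w = 0 -> w = 0.
Proof.
by move=> wA Aw0; apply: dotmx_eq0; rewrite mxrange_orth_ker // mxE.
Qed.

Lemma ker_sub_range (U : {vspace 'cV[R]_n}) :
  (U <= mxrange A)%VS -> (U :&: lker f = 0)%VS.
Proof.
move=> /subvP UA; apply/eqP; rewrite -subv0; apply/subvP => z.
rewrite memv_cap memv_ker mulmx_linfunE memv0 => /andP[zU /eqP Az0].
by apply/eqP/mxrange_ker => //; apply: UA.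
Qed.

Lemma krylov_correction v k :
  (f @: krylov A v k.+1 <= f @: krylov A v k)%VS ->
  exists2 y, y \in krylov A v k & A *m (v - A *m y) = 0.
Proof.
set M := (f @: krylov A v k)%VS => subM.
have MA : (M <= mxrange A)%VS by apply: limgS; apply: subvf.
have fM : (f @: M)%VS = M.
  (* Injectivity of [A] on its range makes the dimensions equal; the inclusion follows from [subM],
     as [M] lies in K_(k+1). *)
  apply/eqP; rewrite eqEdim limg_dim_eq ?ker_sub_range // leqnn andbT.
  by apply: subv_trans subM; apply: limgS; rewrite krylovS addvSr.
have : f v \in (f @: M)%VS.
  rewrite fM (subvP subM) // memv_img // krylovS.
  by rewrite (subvP (addvSl _ _)) // memv_line.
case/memv_imgP => _ /memv_imgP[y yK ->]; rewrite !mulmx_linfunE => Av.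
by exists y; rewrite // mulmxBr Av subrr.
Qed.

Lemma gmres_rsmar_of_correction (b x0 : 'cV[R]_n) k (r0 := b - A *m x0) y :
  (krylov A r0 k :&: lker f = 0)%VS ->
  y \in krylov A r0 k -> A *m (r0 - A *m y) = 0 ->
  is_gmres_iterate A b x0 k (x0 + y) /\ is_rsmar_iterate A b x0 k (x0 + y).
Proof.
move=> injK yK res0.
(* Every residual is split into the candidate's residual, which lies in ker A, and a vector of
   range(A) orthogonal to it. *)
have resE x : b - A *m x = (r0 - A *m y) + A *m (x0 + y - x).
  by rewrite /r0 mulmxBr mulmxDr -[_ - _ - _]addrA -opprD [RHS]addrA subrK.
have resyE : b - A *m (x0 + y) = r0 - A *m y.
  by rewrite resE subrr mulmx0 addr0.
have affy : krylov_affine A b x0 k (x0 + y) by rewrite /krylov_affine addrC addKr.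
have orth z : (A *m z)^T *m (r0 - A *m y) = 0.
  exact: mxrange_orth_ker (mem_mxrange z) res0.
have inj x : krylov_affine A b x0 k x -> A *m (x0 + y - x) = 0 -> x0 + y = x.
  move=> xK Ad0; apply/eqP; rewrite -subr_eq0 -memv0 -injK memv_cap memv_ker.
  rewrite mulmx_linfunE Ad0 eqxx andbT.
  suff -> : x0 + y - x = y - (x - x0) by rewrite rpredB.
  by rewrite opprB addrCA addrA.
split; split.
- by split=> // x _; rewrite resyE resE enorm_leDr.
- move=> x [xK /(_ _ affy)]; rewrite resyE resE => le_res.
  by apply: inj => //; apply: enorm_leDr_eq0 le_res.
- by split=> // x _; rewrite resyE res0 enorm0 enorm_ge0.
(* The optimal value is 0, so another minimizer has A (A d) = 0 with d = x0 + y - x; then A d = 0,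
   as A d is in both range and kernel. *)
- move=> x [xK /(_ _ affy)]; rewrite resyE res0 enorm0 resE mulmxDr res0 add0r.
  by move=> /enorm_le0 /(mxrange_ker (mem_mxrange _)) /inj; apply.
Qed.

Lemma gmres_eq_rsmar (b x0 : 'cV[R]_n) k (r0 := b - A *m x0) :
  (krylov A r0 k :&: lker f = 0)%VS ->
  (f @: krylov A r0 k.+1 <= f @: krylov A r0 k)%VS ->
  exists x xA, [/\ is_gmres_iterate A b x0 k x,
                   is_rsmar_iterate A b x0 k xA & xA = x].
Proof.
move=> injK /krylov_correction[y yK res0].
have [xG xR] := gmres_rsmar_of_correction injK yK res0.
by exists (x0 + y), (x0 + y).
Qed.

Lemma krylov_sub_mxrange v k : v \in mxrange A -> (krylov A v k <= mxrange A)%VS.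
Proof.
move=> vA; apply/span_subvP => _ /mapP[[|i] _ ->] //=.
exact: mem_mxrange.
Qed.

End EqualRanges.

(** * The index l - 1, for a starting vector outside the range *)

Lemma limg_max_krylov_pred v k : v \notin mxrange A ->
  is_max_krylov_dim A v k.+1 ->
  (f @: krylov A v k.+1 <= f @: krylov A v k)%VS.
Proof.
move=> vA hl; have dimS := dim_max_krylov hl.
have := dimv_leqif_sup (limgS f (krylov_sub v (leqnSn k))).
rewrite dim_limg_krylov_pred // => /geq_leqif <-.
(* If A K_(k+1) had dimension k + 1, it would fill K_(k+1) and so contain [v]. *)
rewrite -ltnS -[ltnRHS]dimS ltnNge; apply: contra vA.
have /geq_leqif -> := dimv_leqif_sup (limg_max_krylov hl).
move=> /subvP/(_ v) vf; apply: (subvP (limgS f (subvf _))) (vf _).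
by rewrite krylovS (subvP (addvSl _ _)) // memv_line.
Qed.

(** Rank-nullity on K_k: its image already has dimension [k], an upper bound for dim K_k. *)
Lemma krylov_pred_ker v k : \dim (krylov A v k.+1) = k.+1 ->
  (krylov A v k :&: lker f = 0)%VS.
Proof.
move=> dimS; apply/eqP; rewrite -dimv_eq0 -leqn0.
have := limg_ker_dim f (krylov A v k); rewrite dim_limg_krylov_pred // => dimk.
by rewrite -(leq_add2r k) dimk dim_krylov_le.
Qed.

End Krylov.

Theorem theorem6 (R : realType) (n : nat) (A : 'M[R]_n) (b x0 : 'cV[R]_n)
    (l : nat) (hl : is_max_krylov_dim A (b - A *m x0) l) :
  (mxrange A = mxrange A^T -> b \in mxrange A ->
     exists x xA : 'cV[R]_n,
       [/\ is_gmres_iterate A b x0 l x,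
           is_rsmar_iterate A b x0 l xA
         & xA = x]) /\
  (mxrange A = mxrange A^T -> b \notin mxrange A ->
     exists x xA : 'cV[R]_n,
       [/\ is_gmres_iterate A b x0 (l - 1) x,
           is_rsmar_iterate A b x0 (l - 1) xA
         & xA = x]).
Proof.
have r0A : (b - A *m x0 \in mxrange A) = (b \in mxrange A).
  by rewrite rpredBr ?mem_mxrange.
split=> rangeT; rewrite -r0A => r0P.
  apply: gmres_eq_rsmar => //; last by rewrite max_krylovS.
  by apply: ker_sub_range => //; apply: krylov_sub_mxrange.
(* The truncated [l - 1] is harmless: for [l] = 0, K_1 = K_0 = 0 forces r0 = 0, which lies in the
   range. *)
case: l hl => [|k] hl.
  case/negP: r0P; have /eqP := dim_max_krylov hl.
  rewrite -(max_krylovS hl) dimv_eq0 => /eqP K0.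
  suff : b - A *m x0 \in krylov A (b - A *m x0) 1.
    by rewrite K0 memv0 => /eqP->; apply: mem0v.
  by rewrite krylovS (subvP (addvSl _ _)) // memv_line.
rewrite subn1; apply: gmres_eq_rsmar => //.
  by apply: krylov_pred_ker; apply: dim_max_krylov.
exact: limg_max_krylov_pred.
Qed.
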